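(* Let $d\ge 1$ and suppose that $u(t,y)$ is a (complex-valued) polyharmonic function, of some order $N$, on $(a,b)\times\mathbb{R}^{d}$ which is odd at two different points $t_{1}<t_{2}$ in $(a,b)$. If $a<t_{1}-\delta$ and $t_{2}+\delta<b$ for $\delta:=t_{2}-t_{1}$, then $u$ possesses a polyharmonic extension $\widetilde{u}$ defined on $(-\infty,\infty)\times\mathbb{R}^{d}$ satisfying $$\widetilde{u}\left(t+2(t_{2}-t_{1}),y\right)=\widetilde{u}(t,y)\quad\text{for all }(t,y)\in(-\infty,\infty)\times\mathbb{R}^{d}.$$
   Context: A function $f:G\to\mathbb{C}$ on a domain $G$ in a Euclidean space is polyharmonic of order $N$ if it is $2N$ times continuously differentiable and $\Delta^{N}f=0$ on $G$, where $\Delta$ is the Laplace operator in all variables (here $\Delta=\partial_t^2+\Delta_y$); the extension is polyharmonic of the same order. A function $u:(a,b)\times\mathbb{R}^{d}\to\mathbb{C}$ is odd at $t_{0}\in(a,b)$ if $u(t_{0}+t,y)=-u(t_{0}-t,y)$ for all $|t|<\min\{b-t_{0},t_{0}-a\}$ and all $y\in\mathbb{R}^{d}$. *)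

(* Defs.v *)
From mathcomp Require Import all_boot all_order all_algebra.
From mathcomp Require Import complex.
From mathcomp Require Import all_classical all_reals all_analysis.
Import Order.TTheory GRing.Theory Num.Theory.
Import numFieldNormedType.Exports.

Set Implicit Arguments.
Unset Strict Implicit.
Unset Printing Implicit Defensive.

Local Open Scope classical_set_scope.
Local Open Scope ring_scope.
Local Open Scope complex_scope.

Definition partial (R : realType) (n : nat) (i : 'I_n) (g : 'rV[R]_n -> R) :
    'rV[R]_n -> R :=
  fun x => 'D_(delta_mx 0 i) g x.

(* On an open set [G]: all iterated partial derivatives of [g] of order at most
   [k] exist and are continuous at every point of [G].  As [G] is open, the
   values of the total function [g] outside [G] do not matter. *)
Fixpoint continuously_differentiable (R : realType) (n k : nat)
    (G : set 'rV[R]_n) (g : 'rV[R]_n -> R) : Prop :=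
  (forall x, G x -> {for x, continuous g}) /\
  (if k is k'.+1 then
     forall i : 'I_n, (forall x, G x -> derivable g x (delta_mx 0 i)) /\
                      continuously_differentiable k' G (partial i g)
   else True).

(* R[i] is not a normed module over R, so derivatives of complex-valued
   functions with respect to real variables are taken componentwise. *)
Definition cpartial (R : realType) (n : nat) (i : 'I_n)
    (f : 'rV[R]_n -> R[i]) : 'rV[R]_n -> R[i] :=
  fun x => partial i (fun z => complex.Re (f z)) x
           +i* partial i (fun z => complex.Im (f z)) x.

Definition laplacian (R : realType) (n : nat) (f : 'rV[R]_n -> R[i]) :
    'rV[R]_n -> R[i] :=
  fun x => \sum_(i < n) cpartial i (cpartial i f) x.

Definition polyharmonic (R : realType) (n N : nat) (G : set 'rV[R]_n)
    (f : 'rV[R]_n -> R[i]) : Prop :=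
  [/\ continuously_differentiable (2 * N)%N G (fun z => complex.Re (f z)),
      continuously_differentiable (2 * N)%N G (fun z => complex.Im (f z))
    & forall x, G x -> iter N (@laplacian R n) f x = 0].

(* The point (t, y) of R x R^d, identified with R^(1 + d). *)
Definition pt (R : realType) (d : nat) (t : R) (y : 'rV[R]_d) : 'rV[R]_(1 + d) :=
  row_mx (const_mx t) y.

(* (a, b) x R^d; the end points may be infinite. *)
Definition strip (R : realType) (d : nat) (a b : \bar R) :
    set 'rV[R]_(1 + d) :=
  [set x | exists t y, x = pt t y /\ (a < t%:E < b)%E].

Definition odd_at (R : realType) (d : nat) (a b : \bar R) (t0 : R)
    (u : 'rV[R]_(1 + d) -> R[i]) : Prop :=
  forall (t : R) (y : 'rV[R]_d),
    (`|t|%:E < Order.min (b - t0%:E) (t0%:E - a))%E ->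
    u (pt (t0 + t) y) = - u (pt (t0 - t) y).

(* Main.v *)
Require Import Defs.
From mathcomp Require Import all_boot all_order all_algebra.
From mathcomp Require Import complex.
From mathcomp Require Import all_classical all_reals all_analysis.
From mathcomp Require Import ring lra.
Import Order.TTheory GRing.Theory Num.Theory.
Import numFieldNormedType.Exports.
Local Open Scope classical_set_scope.
Local Open Scope ring_scope.
Local Open Scope complex_scope.

(** The function [w(t, y) = u(t + 2 delta, y) - u(t, y)] is polyharmonic on the
    strip [a < t < b - 2 delta].  For [t1 - delta < t < t1] the two
    reflections, at [t1] and then at [t2], stay in the ranges where oddness is
    assumed, and their composition is the translation by [2 delta]; hence [w]
    vanishes on a thin strip.  Oddness alone does not
    reach further in general, since its range at [t1] or [t2] is limited by the
    nearer end of [(a, b)]; that [w = 0] on the whole strip follows from unique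
    continuation for polyharmonic functions.
    Once [u] is periodic inside its strip, which is wider than one period, the
    extension is obtained by moving each point by a multiple of the period into
    one period interval; near every point it is a translate of [u], so it is
    polyharmonic ([polyharmonic_periodic_extension]).

    Unique continuation ([polyharmonic_unique_continuation]) reduces to
    harmonic functions by induction on the order: the Laplacian has lower order
    and vanishes on the thin strip, so it vanishes, and the function was
    harmonic.  For a harmonic [g] the maximum principle is enough, and no
    regularity is used beyond continuity and the existence of the pure second
    derivatives.  If [g] is
    bounded by [M] on a cube of radius [r], then its difference with its mirror
    image is harmonic, vanishes on the mirror plane, and is dominated by an
    explicit barrier on the half cube, whence
    [|g(c + s e) - g(c - s e)| <= 2 M (n + 1) s / r] ([reflection_estimate]).
    Central differences of [g] are harmonic as well, so the estimate iterates
    with radius [r / j] in each of [j] steps and bounds the [j]-th difference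
    by [M (A j s)^j], a discrete form of the Cauchy estimates.  If [g] vanishes
    on a short segment in direction [e], Newton's forward difference formula
    started there expresses a nearby value of [g] through differences of high
    order only, and refining the grid makes their sum arbitrarily small
    ([vanish_near_to_point]).  The step length depends on the distance to the
    boundary of the strip alone, so finitely many steps reach every point. *)

Set Implicit Arguments.
Unset Strict Implicit.
Unset Printing Implicit Defensive.

(** * Second derivatives at an interior maximum *)

(** Only the existence of [f''(0)] is recorded, without continuity, because this
    notion is stable under sums and reflections and is all that the maximum
    principle uses. *)
Definition has_second_derivative0 (R : realType) (f : R -> R) (l : R) :=
  exists f' : R -> R,
    (\forall t \near (0 : R), is_derive t (1 : R) f (f' t)) /\
    is_derive (0 : R) (1 : R) f' l.

Lemma second_derivative_le0_at_max (R : realType) (f : R -> R) (l : R) :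
  has_second_derivative0 f l -> (\forall t \near (0 : R), f t <= f 0) -> l <= 0.
Proof.
move=> [f' [fd f'd]] fmax.
have [e /= e0 He] : exists2 e : R, 0 < e & forall t : R, `|t| < e ->
    is_derive t (1 : R) f (f' t) /\ f t <= f 0.
  have /nbhs_ballP[e /= e0 He] : \forall t \near (0 : R),
      is_derive t (1 : R) f (f' t) /\ f t <= f 0 by exact: filterI fd fmax.
  exists e => // t te; apply: He; rewrite /ball /= sub0r normrN //.
have ine (a t : R) : a <= e -> t \in `](- a), a[ -> `|t| < e.
  by move=> ae; rewrite in_itv/= -ltr_norml => /lt_le_trans; apply.
have f'0 : f' 0 = 0.
  have D : is_derive (0 : R) (1 : R) f 0.
    apply: (@derive1_at_max R f (- e) e 0).
    - lra.
    - by move=> t /(ine e t (lexx _)) /He[[]].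
    - by rewrite in_itv/=; lra.
    - by move=> t /(ine e t (lexx _)) /He[].
  have [] := He 0; first by rewrite normr0.
  by move=> [_ <-] _; case: D.
(* If [f''(0) > 0] then [f' > 0] to the right of [0], against maximality. *)
rewrite leNgt; apply/negP => l0.
have : \forall h \near (0 : R)^', 0 < h^-1 *: (f' (h *: 1 + 0) - f' 0).
  have [/cvgP C E] := f'd.
  have {C}E : (fun h : R => h^-1 *: ((f' \o shift 0) (h *: 1) - f' 0)) @ 0^' --> l.
    by rewrite -E; case: f'd.
  by move/cvgrPdist_lt/(_ _ l0): E; apply: filterS => h /=; rewrite ltr_norml; lra.
move=> /nbhs_ballP[r /= r0 Hr].
pose m := Num.min e r.
have m0 : 0 < m by rewrite lt_min e0 r0.
have [me mr] : m <= e /\ m <= r by rewrite /m !ge_min !lexx orbT.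
have inm t : t \in `[0, m / 2]%R -> `|t| < e.
  by rewrite in_itv/= => /andP[t0 tm]; rewrite ger0_norm//; lra.
have [c] : exists2 c, c \in `]0, (m / 2)[ & f (m / 2) - f 0 = f' c * (m / 2 - 0).
  apply: MVT; first lra.
    by move=> t tm; have [] := He t; first by apply: inm; apply: subset_itv_oo_cc.
  apply: derivable_within_continuous => t tm.
  by have [[]] := He t (inm t tm).
rewrite in_itv/= => /andP[c0 cm] E.
have [|_ le] := He (m / 2); first by rewrite gtr0_norm; lra.
have := Hr c; rewrite /ball/= sub0r normrN gtr0_norm// f'0 subr0 addr0 => Q.
have {Q} : 0 < c^-1 *: f' (c *: 1) by apply: Q; [lra | rewrite gt_eqF].
rewrite /GRing.scale/= mulr1 pmulr_rgt0 ?invr_gt0// => f'c.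
have : 0 < f' c * (m / 2 - 0) by rewrite mulr_gt0//; lra.
lra.
Qed.

Lemma has_second_derivative0D (R : realType) (f g : R -> R) (k l : R) :
  has_second_derivative0 f k -> has_second_derivative0 g l ->
  has_second_derivative0 (fun t => f t + g t) (k + l).
Proof.
move=> [f' [fd f'd]] [g' [gd g'd]]; exists (fun t => f' t + g' t); split.
  by apply: filterS2 fd gd => t ? ?; apply: is_deriveD.
exact: is_deriveD.
Qed.

Lemma has_second_derivative0N (R : realType) (f : R -> R) (l : R) :
  has_second_derivative0 f l -> has_second_derivative0 (fun t => - f t) (- l).
Proof.
move=> [f' [fd f'd]]; exists (fun t => - f' t); split.
  by apply: filterS fd => t ?; apply: is_deriveN.
exact: is_deriveN.
Qed.

Lemma has_second_derivative0B (R : realType) (f g : R -> R) (k l : R) :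
  has_second_derivative0 f k -> has_second_derivative0 g l ->
  has_second_derivative0 (fun t => f t - g t) (k - l).
Proof.
by move=> ? ?; apply: has_second_derivative0D => //; apply: has_second_derivative0N.
Qed.

Lemma is_derive_reflect (R : realType) (f : R -> R) (t k : R) :
  is_derive (- t) (1 : R) f k -> is_derive t (1 : R) (fun s => f (- s)) (- k).
Proof.
move=> D; have -> : - k = k * -1 by rewrite mulrN1.
exact: (is_derive1_comp D (is_deriveNid t (1 : R))).
Qed.

Lemma has_second_derivative0_reflect (R : realType) (f : R -> R) (l : R) :
  has_second_derivative0 f l -> has_second_derivative0 (fun t => f (- t)) l.
Proof.
move=> [f' [fd f'd]]; exists (fun t => - f' (- t)); split.
  have D : \forall t \near (0 : R), is_derive (- t) (1 : R) f (f' (- t)).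
    move/nbhs_ballP : fd => [e /= e0 He].
    apply/nbhs_ballP; exists e => //= t; rewrite /ball/= sub0r normrN => te.
    by apply: He; rewrite /ball/= sub0r opprK.
  by apply: filterS D => t; exact: is_derive_reflect.
rewrite -(opprK l); apply: is_deriveN; apply: is_derive_reflect.
by rewrite oppr0.
Qed.

Lemma has_second_derivative0_quadratic (R : realType) (a b c : R) :
  has_second_derivative0 (fun t => a + b * t + c * t ^+ 2) (2 * c).
Proof.
exists (fun t => b + 2 * c * t); split.
  apply/nbhs_ballP; exists 1 => //= t _.
  have : is_derive t (1 : R) (cst a + (b \*: id) + (c \*: (id ^+ 2))) (b + 2 * c * t).
    apply: is_derive_eq; rewrite /= /GRing.scale/=; ring.
  by congr (is_derive _ _ _ _); apply/funext => s; rewrite /= !fctE.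
have : is_derive (0 : R) (1 : R) (cst b + ((2 * c) \*: id)) (2 * c).
  apply: is_derive_eq; rewrite /= /GRing.scale/=; ring.
by congr (is_derive _ _ _ _); apply/funext => s; rewrite /= !fctE.
Qed.

(** * Harmonic functions and the mirror image *)

(** Maximum principle: at a positive maximum over [K] the pure second
    derivatives are nonpositive, while their sum is assumed positive there.
    Interiority is asked only where [F > 0], so that the boundary inequality
    may be used in contrapositive form. *)
Lemma le0_of_subharmonic_where_pos (R : realType) (n : nat) (K : set 'rV[R]_n)
    (F : 'rV[R]_n -> R) :
  compact K -> (forall x, K x -> {for x, continuous F}) ->
  (forall x, K x -> 0 < F x ->
     exists l : 'I_n -> R,
       [/\ forall i, has_second_derivative0 (fun t => F (x + t *: delta_mx 0 i)) (l i),
           0 < \sum_i l i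
         & forall i, \forall t \near (0 : R), K (x + t *: delta_mx 0 i)]) ->
  forall x, K x -> F x <= 0.
Proof.
move=> Kc Fc FK x Kx.
have [|c cK cmax] := compact_EVT_max (ex_intro _ x Kx) Kc (f := F).
  by apply: continuous_in_subspaceT => y; rewrite inE; exact: Fc.
rewrite inE in cK.
apply: le_trans (cmax x (mem_set Kx)) _; rewrite leNgt; apply/negP => Fc0.
have [l [ld ls lK]] := FK c cK Fc0.
move: ls; rewrite ltNge => /negP; apply; apply: sumr_le0 => i _.
apply: second_derivative_le0_at_max (ld i) _.
by apply: filterS (lK i) => t Kt; rewrite scale0r addr0; apply/cmax/mem_set.
Qed.

(** The condition is imposed at each point of [S] separately, so [S] may be a
    closed cube and no openness has to be carried along. *)
Definition harmonic_on (R : realType) (n : nat) (S : set 'rV[R]_n)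
    (g : 'rV[R]_n -> R) :=
  forall x, S x -> {for x, continuous g} /\
    exists l : 'I_n -> R,
      (forall i, has_second_derivative0 (fun t => g (x + t *: delta_mx 0 i)) (l i)) /\
      \sum_i l i = 0.

Definition cube (R : realType) (n : nat) (c : 'rV[R]_n) (r : R) : set 'rV[R]_n :=
  [set x | forall i, `|x 0 i - c 0 i| <= r].

Definition mirror (R : realType) (n : nat) (i0 : 'I_n) (a : R) (x : 'rV[R]_n) :=
  x - (2 * (x 0 i0 - a)) *: delta_mx 0 i0.

Section Harmonic.
Context (R : realType) (n : nat).
Implicit Types (S : set 'rV[R]_n) (g h : 'rV[R]_n -> R) (c x v : 'rV[R]_n).

Lemma cube_compact c (r : R) : compact (cube c r).
Proof.
have -> : cube c r =
    [set x | forall i, `[c 0 i - r, c 0 i + r]%classic (x ord0 i)].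
  apply/funext => x; apply/propext; split=> H i; have := H i;
    by rewrite /= in_itv/= ler_distl.
apply: (@rV_compact R n (fun i => `[c 0 i - r, c 0 i + r]%classic)) => i.
exact: segment_compact.
Qed.

Lemma cube_trans c x (r s : R) : cube c r x -> cube x s `<=` cube c (r + s).
Proof.
move=> cx y xy i; rewrite (addrC r).
by apply: le_trans (ler_distD (x 0 i) _ _) _; rewrite lerD.
Qed.

Lemma cube_center c (r : R) : 0 <= r -> cube c r c.
Proof. by move=> r0 i; rewrite subrr normr0. Qed.

Lemma cube_le c (r s : R) : r <= s -> cube c r `<=` cube c s.
Proof. by move=> rs x cx i; exact: le_trans (cx i) rs. Qed.

Lemma cube_shift c i (s : R) : cube c `|s| (c + s *: delta_mx 0 i).
Proof.
move=> j; rewrite !mxE addrAC subrr add0r normrM.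
rewrite eqxx/=; case: eqP => _; rewrite ?andbF ?andbT/= ?mulr1n ?mulr0n ?normr0 ?normr1 ?mulr0 ?mulr1//.
Qed.

Lemma harmonic_on_sub S S' g : S' `<=` S -> harmonic_on S g -> harmonic_on S' g.
Proof. by move=> SS H x /SS /H. Qed.

Lemma harmonic_onB S g h :
  harmonic_on S g -> harmonic_on S h -> harmonic_on S (fun x => g x - h x).
Proof.
move=> Hg Hh x Sx; have [gc [k [kd k0]]] := Hg x Sx.
have [hc [l [ld l0]]] := Hh x Sx; split; first exact: continuousB.
exists (fun i => k i - l i); split; last by rewrite sumrB k0 l0 subrr.
by move=> i; apply: has_second_derivative0B.
Qed.

Lemma harmonic_onN S g : harmonic_on S g -> harmonic_on S (fun x => - g x).
Proof.
move=> Hg x Sx; have [gc [k [kd k0]]] := Hg x Sx; split; first exact: continuousN.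
exists (fun i => - k i); split; last by rewrite sumrN k0 oppr0.
by move=> i; apply: has_second_derivative0N.
Qed.

Lemma continuous_for_shift g v x :
  {for x + v, continuous g} -> {for x, continuous (fun y : 'rV[R]_n => g (y + v))}.
Proof.
move=> gc; apply: (@continuous_comp _ _ _ (fun y : 'rV[R]_n => y + v) g) => //.
by apply: (@continuousD _ _ _ id (cst v) x); [move=> ? ? | exact: cst_continuous].
Qed.

Lemma harmonic_on_shift S S' g v :
  harmonic_on S g -> (forall x, S' x -> S (x + v)) ->
  harmonic_on S' (fun x => g (x + v)).
Proof.
move=> Hg SS x /SS Sx; have [gc [k [kd k0]]] := Hg _ Sx; split.
  exact: continuous_for_shift.
exists k; split => // i; have := kd i; congr has_second_derivative0.
by apply/funext => t; rewrite addrAC.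
Qed.

Lemma mirrorE i0 (a : R) x i :
  mirror i0 a x 0 i = if i == i0 then 2 * a - x 0 i else x 0 i.
Proof. by rewrite !mxE eqxx/=; case: eqP => [->|_]; rewrite /=; ring. Qed.

Lemma mirror_along i0 (a : R) x i (t : R) :
  mirror i0 a (x + t *: delta_mx 0 i) =
  mirror i0 a x + (if i == i0 then - t else t) *: delta_mx 0 i.
Proof.
rewrite /mirror !mxE eqxx/= (eq_sym i0 i); apply/rowP => j; rewrite !mxE/=.
by case: (eqVneq i i0) => [->|_]; rewrite /=; ring.
Qed.

Lemma mirror_continuous i0 (a : R) : continuous (@mirror R n i0 a).
Proof.
move=> x; apply: (@continuousB _ _ _ id (fun y : 'rV[R]_n => (2 * (y 0 i0 - a)) *: delta_mx 0 i0)).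
  by move=> ? ?.
have C : continuous (fun y : 'rV[R]_n => 2 * (y 0 i0 - a)).
  move=> y; apply: (@continuousM _ _ (cst 2) (fun y : 'rV[R]_n => y 0 i0 - a)); first exact: cst_continuous.
  by apply: (@continuousB _ _ _ (fun y : 'rV[R]_n => y 0 i0) (cst a)); [exact: coord_continuous | exact: cst_continuous].
exact: (cvgZr_tmp (a := delta_mx 0 i0) (C x)).
Qed.

Lemma harmonic_on_mirror S g i0 (a : R) :
  harmonic_on S g -> harmonic_on (mirror i0 a @^-1` S) (g \o mirror i0 a).
Proof.
move=> Hg x Sx; have [gc [k [kd k0]]] := Hg _ Sx; split.
  by apply: continuous_comp => //; exact: mirror_continuous.
exists k; split => // i.
under [X in has_second_derivative0 X]funext do rewrite /= mirror_along.
have := kd i; case: (i == i0) => //; exact: has_second_derivative0_reflect.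
Qed.

End Harmonic.

(** * The reflection estimate *)

Section ReflectionEstimate.
Context (R : realType) (n : nat) (i0 : 'I_n).
Implicit Types (g : 'rV[R]_n -> R) (c x : 'rV[R]_n).

(** The weights have sum [-1], so the barrier has Laplacian [-2]: it is strictly
    superharmonic. *)
Definition barrier_weight (i : 'I_n) : R := if i == i0 then - n%:R else 1.

Definition barrier (c : 'rV[R]_n) (r : R) (x : 'rV[R]_n) : R :=
  n.+1%:R * r * (x 0 i0 - c 0 i0) +
  \sum_i barrier_weight i * (x 0 i - c 0 i) ^+ 2.

Lemma sum_barrier_weight : \sum_i barrier_weight i = - 1.
Proof.
rewrite (bigD1 i0)//= {1}/barrier_weight eqxx.
under eq_bigr => i /negbTE ni do rewrite /barrier_weight ni.
rewrite sumr_const (cardC1 i0) card_ord.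
have n0 : (0 < n)%N by case: n i0 => // -[].
by rewrite -[in - _](prednK n0) mulrSr; ring.
Qed.

(** On the half cube the bracket is at least [r (x_i0 - c_i0)], because
    [x_i0 - c_i0 <= r]; thus the barrier is nonnegative, and at least [r^2] on
    every face of the half cube other than the mirror plane. *)
Lemma barrierE c (r : R) x : barrier c r x =
  (n.+1%:R * r * (x 0 i0 - c 0 i0) - n%:R * (x 0 i0 - c 0 i0) ^+ 2) +
  \sum_(i | i != i0) (x 0 i - c 0 i) ^+ 2.
Proof.
rewrite /barrier (bigD1 i0)//= {1}/barrier_weight eqxx addrA mulNr; congr (_ + _).
by apply: eq_bigr => i /negbTE ni; rewrite /barrier_weight ni mul1r.
Qed.

Lemma barrier_continuous c (r : R) : continuous (barrier c r).
Proof.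
have C i : continuous (fun x : 'rV[R]_n => x 0 i - c 0 i).
  move=> x; apply: (@continuousB _ _ _ (fun y : 'rV[R]_n => y 0 i) (cst (c 0 i))).
    exact: coord_continuous.
  exact: cst_continuous.
move=> x; apply: (@continuousD _ _ _
    (fun x : 'rV[R]_n => n.+1%:R * r * (x 0 i0 - c 0 i0))
    (fun x : 'rV[R]_n => \sum_i barrier_weight i * (x 0 i - c 0 i) ^+ 2)).
  by apply: (@continuousM _ _ (cst _) _ x (@cst_continuous _ _ _ x) (C i0 x)).
apply: (@continuous_big _ _ _ _ _ _ _ _ _) => [|i _ {}x]; first exact: add_continuous.
apply: (@continuousM _ _ (cst _) _ x (@cst_continuous _ _ _ x)).
exact: (@continuousM _ _ _ _ x (C i x) (C i x)).
Qed.

Lemma barrier_second_derivative c (r k : R) x i : has_second_derivative0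
  (fun t => k * barrier c r (x + t *: delta_mx 0 i)) (2 * k * barrier_weight i).
Proof.
pose b0 := n.+1%:R * r * (x 0 i0 - c 0 i0) +
  \sum_j barrier_weight j * (x 0 j - c 0 j) ^+ 2.
pose b1 := n.+1%:R * r * (i == i0)%:R + barrier_weight i * (2 * (x 0 i - c 0 i)).
have := has_second_derivative0_quadratic (k * b0) (k * b1) (k * barrier_weight i).
rewrite mulrA; congr has_second_derivative0; apply/funext => t.
rewrite /barrier /b0 /b1 (bigD1 i)//= [in RHS](bigD1 i)//=.
rewrite [in RHS](eq_bigr (fun j => barrier_weight j * (x 0 j - c 0 j) ^+ 2)).
  by rewrite !mxE !eqxx/= (eq_sym i0 i); ring.
by move=> j ji; rewrite !mxE eqxx/= (negbTE ji) mulr0 addr0.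
Qed.

(** The function [F] below is the difference of [g] with its mirror image,
    minus the barrier scaled so as to reach [2 M] on the outer faces of the
    half cube [K].  On the mirror plane the two terms with [g] cancel.  So [F]
    can be positive only in the interior of [K], where its Laplacian is
    positive. *)
Lemma reflection_estimate_le (c : 'rV[R]_n) (r M s : R) g :
  0 < r -> 0 < M -> harmonic_on (cube c r) g ->
  (forall x, cube c r x -> `|g x| <= M) -> 0 <= s <= r ->
  g (c + s *: delta_mx 0 i0) - g (c - s *: delta_mx 0 i0)
    <= 2 * M * n.+1%:R * s / r.
Proof.
move=> r0 M0 Hg gM /andP[s0 sr].
pose K := [set x | cube c r x /\ c 0 i0 <= x 0 i0].
pose m := mirror i0 (c 0 i0).
pose k := 2 * M / r ^+ 2.
have k0 : 0 < k by rewrite divr_gt0// ?mulr_gt0// exprn_gt0.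
pose F x := (g x - g (m x)) - k * barrier c r x.
have mK x : cube c r x -> cube c r (m x).
  move=> Kx i; rewrite mirrorE; case: eqP => [->|_]; last exact: Kx.
  by rewrite (_ : _ - _ = - (x 0 i0 - c 0 i0)) ?normrN//; ring.
have hm : harmonic_on (cube c r) (g \o m).
  by apply: harmonic_on_sub (harmonic_on_mirror (i0 := i0) (a := c 0 i0) Hg).
have hF := harmonic_onB Hg hm.
have Kc : compact K.
  have -> : K = [set x | forall i, `[if i == i0 then c 0 i else c 0 i - r,
      c 0 i + r]%classic (x ord0 i)].
    apply/funext => x; apply/propext; split => [[cx x0] i|H].
      have := cx i; rewrite /= in_itv/= ler_distl => /andP[xl ->].
      by rewrite andbT; case: eqP => [->|].
    split=> [i|]; last by have := H i0; rewrite /= in_itv/= eqxx => /andP[].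
    have := H i; rewrite /= in_itv/= ler_distl => /andP[+ ->]; rewrite andbT.
    by case: eqP => _; lra.
  apply: (@rV_compact R n (fun i => `[if i == i0 then c 0 i else c 0 i - r,
      c 0 i + r]%classic)) => i.
  exact: segment_compact.
have FK x : K x -> F x <= 0.
  apply: (le0_of_subharmonic_where_pos Kc) => {}x [cx x0].
    have [Fc _] := hF x cx.
    apply: (@continuousB _ _ _ (fun x => g x - g (m x)) (fun x => k * barrier c r x)) => //.
    apply: (@continuousM _ _ (cst _) _ x (@cst_continuous _ _ _ x)).
    exact: barrier_continuous.
  move=> Fx; have [_ [l [ld l0]]] := hF x cx.
  exists (fun i => l i - 2 * k * barrier_weight i); split.
  - by move=> i; apply: has_second_derivative0B (ld i) (barrier_second_derivative c r k x i).
  - by rewrite sumrB l0 -mulr_sumr sum_barrier_weight; lra.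
  have [xr1 xr2] : x 0 i0 - c 0 i0 <= r /\ 0 <= x 0 i0 - c 0 i0.
    by split; [exact: le_trans (ler_norm _) (cx i0) | rewrite subr_ge0].
  have gm2 : g x - g (m x) <= 2 * M.
    have := gM x cx; have := gM _ (mK x cx); rewrite !ler_norml; lra.
  have n0 : (0 : R) <= n%:R by rewrite ler0n.
  have lin : r * (x 0 i0 - c 0 i0) <=
      n.+1%:R * r * (x 0 i0 - c 0 i0) - n%:R * (x 0 i0 - c 0 i0) ^+ 2.
    rewrite -subr_ge0 -natr1.
    have := mulr_ge0 (mulr_ge0 n0 xr2) (eq_ind_r is_true xr1 (subr_ge0 _ _)).
    lra.
  (* [barrier c r x < r^2] at a point with [F x > 0] keeps it off the outer
     faces. *)
  have r2b : barrier c r x < r ^+ 2.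
    rewrite ltNge; apply/negP => rb.
    have : k * r ^+ 2 <= k * barrier c r x by rewrite ler_pM2l.
    rewrite /k divfK ?gt_eqF ?exprn_gt0// -/k; move: Fx; rewrite /F; lra.
  have sumge : 0 <= \sum_(i | i != i0) (x 0 i - c 0 i) ^+ 2.
    by apply: sumr_ge0 => i _; exact: sqr_ge0.
  have rx0 : 0 <= r * (x 0 i0 - c 0 i0) by rewrite mulr_ge0// ltW.
  have xi i : i != i0 -> `|x 0 i - c 0 i| < r.
    move=> ii0; rewrite -(@ltr_pXn2r _ 2)// ?nnegrE// ?ltW// real_normK ?num_real//.
    apply: le_lt_trans r2b; rewrite barrierE (bigD1 i)//=.
    have : 0 <= \sum_(j | (j != i0) && (j != i)) (x 0 j - c 0 j) ^+ 2.
      by apply: sumr_ge0 => j _; exact: sqr_ge0.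
    lra.
  have x0lt : x 0 i0 - c 0 i0 < r.
    rewrite -(ltr_pM2l r0) -expr2; apply: le_lt_trans r2b; rewrite barrierE; lra.
  have x0gt : c 0 i0 < x 0 i0.
    rewrite lt_neqAle x0 andbT; apply/eqP => E.
    have mx : m x = x.
      apply/rowP => i; rewrite mirrorE; case: eqP => [->|//].
      by rewrite E mulr_natl mulr2n addrK.
    move: Fx; rewrite /F mx subrr barrierE -E subrr.
    have := mulr_ge0 (ltW k0) sumge; lra.
  move=> i; pose e := if i == i0 then Num.min (r - (x 0 i0 - c 0 i0)) (x 0 i0 - c 0 i0)
                      else r - `|x 0 i - c 0 i|.
  have e0 : 0 < e.
    rewrite /e; case: eqP => [_|/eqP/xi]; last by rewrite subr_gt0.
    by rewrite lt_min !subr_gt0 x0lt.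
  apply/nbhs_ballP; exists e => // t; rewrite /ball/= sub0r normrN /e => te.
  split.
    move=> j; rewrite !mxE eqxx/=; case: (eqVneq j i) => [->|_]; last first.
      by rewrite mulr0 addr0; exact: cx.
    move: te; case: eqP => [->|_] te; last first.
      by rewrite mulr1 addrAC; apply: le_trans (ler_normD _ _) _; lra.
    move: te; rewrite lt_min !ltr_norml ler_norml mulr1; lra.
  rewrite !mxE eqxx/=; move: te; rewrite (eq_sym i0 i); case: eqP => [_|_] te.
    by move: te; rewrite lt_min !ltr_norml mulr1; lra.
  by rewrite mulr0 addr0.
have cK : K (c + s *: delta_mx 0 i0).
  split; first by apply: cube_le (cube_shift _ _ _); rewrite ger0_norm.
  by rewrite !mxE !eqxx mulr1 lerDl.
have := FK _ cK; rewrite /F.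
have -> : m (c + s *: delta_mx 0 i0) = c - s *: delta_mx 0 i0.
  rewrite /m mirror_along eqxx; apply/rowP => i; rewrite !mxE; ring.
rewrite barrierE big1 => [|i ni]; last first.
  by rewrite !mxE eqxx/= (negbTE ni) mulr0 addr0 subrr expr0n.
rewrite !mxE !eqxx mulr1 (addrAC (c 0 i0)) subrr add0r addr0.
have : k * (n.+1%:R * r * s - n%:R * s ^+ 2) <= 2 * M * n.+1%:R * s / r.
  rewrite (_ : 2 * M * _ * s / r = k * (n.+1%:R * r * s)); last first.
    by rewrite /k; field; rewrite gt_eqF.
  rewrite ler_pM2l// gerBl mulr_ge0// sqr_ge0//.
lra.
Qed.

Lemma reflection_estimate (c : 'rV[R]_n) (r M s : R) g :
  0 < r -> 0 < M -> harmonic_on (cube c r) g ->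
  (forall x, cube c r x -> `|g x| <= M) -> `|s| <= r ->
  `|g (c + s *: delta_mx 0 i0) - g (c - s *: delta_mx 0 i0)|
    <= 2 * M * n.+1%:R * `|s| / r.
Proof.
move=> r0 M0.
wlog s0 : s g / 0 <= s.
  move=> W Hg gM sr; have [s0|s0] := leP 0 s; first exact: W.
  have := W (- s) g; rewrite normrN scaleNr opprK distrC; apply => //; lra.
move=> Hg gM; rewrite ger0_norm// => sr; rewrite ler_norml; apply/andP; split; last first.
  by apply: reflection_estimate_le => //; rewrite s0.
have := @reflection_estimate_le c r M s (fun x => - g x) r0 M0 (harmonic_onN Hg).
have gM' x : cube c r x -> `|- g x| <= M by move=> /gM; rewrite normrN.
by move=> /(_ gM'); rewrite s0 => /(_ sr); lra.
Qed.

End ReflectionEstimate.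

(** * Finite differences *)

(** [j^j / j!] is at most the central binomial coefficient, since
    [(j+1) ... (2j) >= j^j]. *)
Lemma expn_self_le_fact j : (j ^ j <= 4 ^ j * j`!)%N.
Proof.
have bin2 : ('C(2 * j, j) <= 4 ^ j)%N.
  rewrite -[4%N]/(2 ^ 2)%N -expnM -[2%N in X in (_ <= X)%N]/(1 + 1)%N expnDn.
  have jlt : (j < (2 * j).+1)%N by rewrite ltnS leq_pmull.
  by rewrite (bigD1 (Ordinal jlt))//= !exp1n !muln1 leq_addr.
apply: leq_trans (leq_mul bin2 (leqnn _)); rewrite bin_ffact ffact_prod.
rewrite -iter_muln_1 -big_const_ord.
by apply: leq_prod => i _; rewrite mul2n -addnn -addnBA ?leq_addr// ltnW.
Qed.

(** This offsets the factor [j^j] that the iterated reflection estimate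
    produces against the binomial coefficients of Newton's formula. *)
Lemma bin_expn_self_le K j : ('C(K, j) * j ^ j <= (4 * K) ^ j)%N.
Proof.
apply: leq_trans (leq_mul (leqnn _) (expn_self_le_fact j)) _.
rewrite mulnCA bin_ffact expnMn leq_mul2l ffact_prod; apply/orP; right.
rewrite -[leqRHS]iter_muln_1 -big_const_ord.
by apply: leq_prod => i _; rewrite leq_subr.
Qed.

Definition forward_diff (V : zmodType) (f : nat -> V) (k : nat) := f k.+1 - f k.

Lemma newton_forward (R : pzRingType) (f : nat -> R) K :
  f K = \sum_(j < K.+1) 'C(K, j)%:R * iter j (@forward_diff R) f 0%N.
Proof.
elim: K f => [|K IH] f; first by rewrite big_ord1 bin0 mul1r.
have -> : f K.+1 = forward_diff f K + f K by rewrite /forward_diff subrK.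
rewrite (IH (forward_diff f)) (IH f).
under eq_bigr => j _ do rewrite -iterSr.
rewrite [X in _ + X = _]big_ord_recl [RHS]big_ord_recl !bin0 addrCA; congr (_ + _).
under [RHS]eq_bigr => j _ do rewrite /= /bump add1n binS natrD mulrDl.
rewrite big_split/= addrC; congr (_ + _).
by rewrite [RHS]big_ord_recr/= bin_small// mul0r addr0.
Qed.

Lemma iter_forward_diff_eq0 (V : zmodType) (f : nat -> V) j k :
  (forall i, (i <= k + j)%N -> f i = 0) -> iter j (@forward_diff V) f k = 0.
Proof.
elim: j k => [|j IH] k f0; first by apply: f0; rewrite addn0.
rewrite iterS /forward_diff !IH ?subrr// => i ik; apply: f0.
  by rewrite addnS leqW.
by rewrite addnS -addSn.
Qed.

Lemma sum_half_tail_le (R : realFieldType) (N L : nat) :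
  \sum_(j < L | (N < j)%N) (1 / 2 : R) ^+ j <= (1 / 2) ^+ N.
Proof.
have half_ge0 k : 0 <= (1 / 2 : R) ^+ k by rewrite exprn_ge0.
have H p : \sum_(j < N.+1 + p | (N < j)%N) (1 / 2 : R) ^+ j =
    (1 / 2) ^+ N - (1 / 2) ^+ (N + p).
  elim: p => [|p IH].
    rewrite !addn0 subrr big1// => j Nj.
    by have := ltn_ord j; rewrite ltnS leqNgt Nj.
  rewrite addnS big_mkcond big_ord_recr -big_mkcond IH /=.
  rewrite ltn_addr// addSn addnS exprS; lra.
have [LN|/ltnW NL] := leqP L N.+1.
  rewrite big1 ?half_ge0// => j Nj.
  by have := leq_trans (ltn_ord j) LN; rewrite ltnS leqNgt Nj.
by rewrite -(subnKC NL) H gerBl half_ge0.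
Qed.

Lemma eq0_of_le_half_expn (R : realType) (x M : R) :
  (forall N, `|x| <= M * (1 / 2) ^+ N.+1) -> x = 0.
Proof.
move=> H; apply/eqP; rewrite -normr_eq0; apply/contraT => x0.
have xp : 0 < `|x| by rewrite lt_def x0 normr_ge0.
have [N MN] : exists N : nat, M / `|x| < N%:R.
  exists (Num.bound `|M / `|x| |).
  by apply: le_lt_trans (ler_norm _) (archi_boundP (normr_ge0 _)).
move: MN; rewrite ltr_pdivrMr// => MN.
have := H N; rewrite expr_div_n expr1n mulrA mulr1 ler_pdivlMr ?exprn_gt0// => HN.
have : N%:R * `|x| <= `|x| * 2 ^+ N.+1.
  rewrite mulrC ler_pM2l// -natrX ler_nat.
  by apply: leq_trans (ltnW (ltn_expl N (ltnSn 1))) _; rewrite leq_exp2l.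
lra.
Qed.

(** * Unique continuation for harmonic functions *)

Section UniqueContinuation.
Context (R : realType) (n : nat) (i0 : 'I_n).
Implicit Types (g : 'rV[R]_n -> R) (c x q : 'rV[R]_n).

Local Notation e := (delta_mx (0 : 'I_1) i0 : 'rV[R]_n).

Definition central_diff (s : R) g x := g (x + (s / 2) *: e) - g (x - (s / 2) *: e).

(** Each central difference costs one layer of width [r] of the cube, and turns
    the bound [M] into [M (n + 1) |s| / r] by the reflection estimate. *)
Lemma iter_central_diff_le j g c (r M s : R) :
  0 < r -> 0 < M -> s != 0 -> `|s| / 2 <= r ->
  harmonic_on (cube c (j%:R * r)) g ->
  (forall x, cube c (j%:R * r) x -> `|g x| <= M) ->
  `|iter j (central_diff s) g c| <= M * (n.+1%:R * `|s| / r) ^+ j.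
Proof.
move=> r0; elim: j g M => [|j IH] g M M0 sn0 sr.
  by rewrite mul0r mulr1 => _; apply; exact: cube_center.
have r1 : j.+1%:R * r = j%:R * r + r by rewrite -natr1 mulrDl mul1r.
rewrite r1 iterSr exprS mulrA => Hg gM.
have s2 : `|s / 2| = `|s| / 2 by rewrite normrM [X in _ * X]gtr0_norm.
apply: IH => //.
- by rewrite !mulr_gt0 ?invr_gt0 ?normr_gt0.
- have sub x : cube c (j%:R * r) x -> cube c (j%:R * r + r) (x + (s / 2) *: e).
    move=> cx; apply: (cube_trans cx); apply: cube_le (cube_shift _ _ _).
    by rewrite s2.
  have subN x : cube c (j%:R * r) x -> cube c (j%:R * r + r) (x - (s / 2) *: e).
    move=> cx; apply: (cube_trans cx); rewrite -scaleNr.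
    by apply: cube_le (cube_shift _ _ _); rewrite normrN s2.
  exact: (harmonic_onB (harmonic_on_shift Hg sub) (harmonic_on_shift Hg subN)).
- move=> x cx; rewrite /central_diff.
  apply: le_trans (reflection_estimate (M := M) i0 r0 M0 _ _ _) _.
  + exact: harmonic_on_sub (cube_trans cx) Hg.
  + by move=> y xy; apply: gM; exact: cube_trans cx _ xy.
  + by rewrite s2.
  + by rewrite s2 (_ : 2 * M * _ * _ / r = M * (n.+1%:R * `|s| / r))//; field; rewrite gt_eqF.
Qed.

(** Forward differences along a grid are central differences taken at the
    middle of the stencil. *)
Lemma iter_forward_diff_along (s : R) g x j k :
  iter j (@forward_diff R) (fun i => g (x + (i%:R * s) *: e)) k =
  iter j (central_diff s) g (x + (k%:R * s + j%:R * s / 2) *: e).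
Proof.
elim: j k => [|j IH] k; first by rewrite !mul0r addr0.
rewrite iterS {1}/forward_diff !IH iterS {3}/central_diff.
have E1 : k.+1%:R * s + j%:R * s / 2 = k%:R * s + j.+1%:R * s / 2 + s / 2 :> R.
  by rewrite -!natr1; field.
have E2 : k%:R * s + j%:R * s / 2 = k%:R * s + j.+1%:R * s / 2 - s / 2 :> R.
  by rewrite -!natr1; field.
by rewrite E1 E2 !scalerDl scaleNr !addrA.
Qed.

Lemma cube_norm_bounded c (r : R) g : harmonic_on (cube c r) g ->
  exists2 M, 0 < M & forall x, cube c r x -> `|g x| <= M.
Proof.
move=> Hg; have [r0|r0] := ltP r 0.
  exists 1 => // x /(_ i0) xr; have := le_lt_trans xr r0.
  by rewrite ltNge normr_ge0.
have [|m cm mmax] := compact_EVT_max (ex_intro _ c (cube_center c r0))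
    (@cube_compact R n c r) (f := fun x => `|g x|).
  apply: continuous_in_subspaceT => y; rewrite inE => /Hg[gc _].
  exact: (@continuous_comp _ _ _ g Num.norm y gc (@norm_continuous _ _ _)).
exists (`|g m| + 1) => [|x cx]; first by rewrite ltr_wpDl.
by have := mmax x (mem_set cx); lra.
Qed.

(** The reach [r / (8 (n + 1))] of the conclusion does not depend on [eta].  Its
    constant is chosen so that [4 (n + 1) |sigma| / r <= 1 / 2], where the
    factor [4] comes from [bin_expn_self_le]: the surviving terms of Newton's
    formula are then dominated by a geometric series of ratio [1 / 2]. *)
Lemma vanish_near_to_point g q (r eta sigma : R) :
  0 < r -> 0 < eta -> harmonic_on (cube q (2 * r)) g ->
  (forall tau, `|tau| <= eta -> g (q + tau *: e) = 0) ->
  8 * n.+1%:R * `|sigma| <= r -> g (q + sigma *: e) = 0.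
Proof.
move=> r0 eta0 Hg g0 sr.
have [->|sigma0] := eqVneq sigma 0; first by apply: g0; rewrite normr0 ltW.
have sp : 0 < `|sigma| by rewrite normr_gt0.
have n1 : (1 : R) <= n.+1%:R by rewrite ler1n.
have sigr : `|sigma| <= r.
  have : `|sigma| <= n.+1%:R * `|sigma| by rewrite ler_peMl.
  lra.
have [M M0 gM] := cube_norm_bounded Hg.
(* The grid from [q] to [q + sigma e] has [m (N + 1)] steps, so that its first
   [N + 1] steps stay within distance [eta] of [q], where [g] vanishes.  Only
   differences of order larger than [N + 1] then survive. *)
pose m := (Num.bound (`|sigma| / eta)).+1.
have sm : `|sigma| <= m%:R * eta.
  rewrite -ler_pdivrMr// -natr1; apply: ltW; apply: lt_le_trans (archi_boundP _) _.
    by rewrite divr_ge0// ltW.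
  by rewrite lerDl.
apply: (@eq0_of_le_half_expn _ _ M) => N.
pose K := (m * N.+1)%N.
have K0 : (0 : R) < K%:R by rewrite ltr0n muln_gt0.
have [s sE] : exists s, K%:R * s = sigma.
  by exists (sigma / K%:R); rewrite mulrC divfK ?gt_eqF.
have Ks : K%:R * `|s| = `|sigma| by rewrite -sE normrM (gtr0_norm K0).
have s0 : s != 0.
  by apply: contra_neq sigma0 => s0; rewrite -sE s0 mulr0.
pose f i := g (q + (i%:R * s) *: e).
have -> : g (q + sigma *: e) = f K by rewrite /f sE.
rewrite newton_forward (bigID (fun j : 'I_K.+1 => (N.+1 < j)%N))/= [X in _ + X]big1.
  rewrite addr0; apply: le_trans (ler_norm_sum _ _ _) _.
  apply: le_trans (ler_wpM2l (ltW M0) (sum_half_tail_le R N.+1 K.+1)).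
  rewrite mulr_sumr; apply: ler_sum => j Nj.
  have j0 : (0 : R) < j%:R by rewrite ltr0n (leq_trans _ Nj).
  have js : j%:R * `|s| <= `|sigma|.
    by rewrite -Ks ler_wpM2r// ler_nat -ltnS ltn_ord.
  rewrite (iter_forward_diff_along s g q j 0) mul0r add0r normrM [X in X * _]ger0_norm//.
  set c := q + _.
  have cq : cube q r c.
    apply: cube_le (cube_shift _ _ _); rewrite !normrM normfV.
    rewrite !normr_nat; have := normr_ge0 s; lra.
  have jr : j%:R * (r / j%:R) = r by rewrite mulrC divfK ?gt_eqF.
  have sub : cube c r `<=` cube q (2 * r).
    by rewrite mulr_natl mulr2n; exact: cube_trans.
  (* The cube of radius [r] about [c] is split into [j] layers. *)
  have B : `|iter j (central_diff s) g c| <= M * (n.+1%:R * `|s| / (r / j%:R)) ^+ j.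
    apply: iter_central_diff_le => //.
    - by rewrite divr_gt0.
    - by rewrite ler_pdivlMr//; have := normr_ge0 s; lra.
    - by rewrite jr; exact: harmonic_on_sub Hg.
    - by rewrite jr => x /sub /gM.
  apply: le_trans (ler_wpM2l (ler0n _ _) B) _.
  pose a := n.+1%:R * `|s| / r.
  have a0 : 0 <= a by rewrite !mulr_ge0// invr_ge0 ltW.
  have -> : n.+1%:R * `|s| / (r / j%:R) = a * j%:R.
    by rewrite /a; field; rewrite !gt_eqF.
  rewrite mulrCA; apply: ler_wpM2l; first exact: ltW.
  apply: (@le_trans _ _ ((a * (4 * K%:R)) ^+ j)).
    rewrite !(exprMn _ a) mulrCA; apply: ler_wpM2l; first exact: exprn_ge0.
    by rewrite -!natrX -natrM -natrM -natrX ler_nat; exact: bin_expn_self_le.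
  apply: lerXn2r; rewrite ?nnegrE; [by apply: (mulr_ge0 a0); apply: mulr_ge0 | by rewrite divr_ge0 |].
  rewrite (_ : a * _ = 4 * n.+1%:R * (K%:R * `|s|) / r); last by rewrite /a; ring.
  rewrite Ks ler_pdivrMr//; lra.
move=> j; rewrite -leqNgt => jN; rewrite iter_forward_diff_eq0 ?mulr0// => i.
rewrite add0n => ij; apply: g0; rewrite normrM ger0_norm//.
rewrite -(ler_pM2l K0) mulrCA Ks /K natrM.
have iN : (i%:R : R) <= N.+1%:R by rewrite ler_nat (leq_trans ij).
apply: le_trans (ler_wpM2r (ltW sp) iN) _.
by rewrite mulrAC mulrC ler_wpM2r// (le_trans sm).
Qed.

(** The hypothesis propagates in steps of a fixed length, because all cubes
    centred on the segment have the same radius.  Each step reproduces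
    vanishing on a neighbourhood of the same size [z]. *)
Lemma vanish_along_segment g x (r eta T : R) :
  0 < r -> 0 < eta ->
  (forall th, 0 <= th <= 1 -> harmonic_on (cube (x + (th * T) *: e) (2 * r)) g) ->
  (forall tau, `|tau| <= eta -> g (x + tau *: e) = 0) ->
  g (x + T *: e) = 0.
Proof.
move=> r0 eta0 Hg g0.
have n1 : (0 : R) < 16 * n.+1%:R by rewrite mulr_gt0.
(* Half the reach of a single step: one half is used to advance, the other half
   to cover a neighbourhood of the new point. *)
pose rho := r / (16 * n.+1%:R).
have rho0 : 0 < rho by rewrite divr_gt0.
pose z := Num.min eta rho.
have z0 : 0 < z by rewrite lt_min eta0 rho0.
have [zeta zrho] : z <= eta /\ z <= rho by rewrite /z !ge_min !lexx orbT.
pose N := (Num.bound (`|T| / rho)).+1.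
have N0 : (0 : R) < N%:R by rewrite ltr0n.
have TN : `|T / N%:R| <= rho.
  rewrite normrM normfV [X in _ / X]gtr0_norm// ler_pdivrMr// mulrC -ler_pdivrMr//.
  rewrite -natr1; apply: ltW; apply: lt_le_trans (archi_boundP _) _.
    by rewrite divr_ge0// ltW.
  by rewrite lerDl.
have H i : (i <= N)%N -> forall tau, `|tau| <= z ->
    g (x + (i%:R * (T / N%:R) + tau) *: e) = 0.
  elim: i => [_ tau tz|i IH iN tau tz].
    by rewrite mul0r add0r; apply: g0; exact: le_trans tz zeta.
  have -> : x + (i.+1%:R * (T / N%:R) + tau) *: e =
      x + (i%:R * (T / N%:R)) *: e + (T / N%:R + tau) *: e.
    by rewrite -(addrA x) -scalerDl addrA -natr1 mulrDl mul1r.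
  apply: (vanish_near_to_point (eta := z) r0) => //.
  - have -> : i%:R * (T / N%:R) = i%:R / N%:R * T by rewrite mulrAC mulrA.
    apply: Hg; rewrite divr_ge0//= ler_pdivrMr// mul1r ler_nat; exact: ltnW.
  - by move=> t tz'; rewrite -addrA -scalerDl; apply: IH => //; exact: ltnW.
  - have : `|T / N%:R + tau| <= rho + rho.
      by apply: le_trans (ler_normD _ _) (lerD TN (le_trans tz zrho)).
    move/(ler_wpM2l (ltW n1)); rewrite /rho mulrDr.
    by rewrite [_ * (r / _)]mulrC divfK ?gt_eqF//; lra.
have := H N (leqnn _) 0; rewrite normr0 addr0 mulrC divfK ?gt_eqF//.
by apply; exact: ltW.
Qed.

Definition slab (I : set R) : set 'rV[R]_n := [set x | I (x 0 i0)].

(** A slab is unbounded in the other directions, so the cubes around the points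
    of the segment from [a] to [x_i0] are restricted by the distance from that
    segment to the complement of [I] only; convexity of [I] bounds this
    distance from below by its values at the two end points. *)
Lemma harmonic_unique_continuation (I J : set R) g :
  open I -> is_interval I -> open J -> J !=set0 -> J `<=` I ->
  harmonic_on (slab I) g -> (forall x, slab J x -> g x = 0) ->
  forall x, slab I x -> g x = 0.
Proof.
move=> Io Ii Jo [a Ja] JI Hg g0 x Ix.
have op (A : set R) t : open A -> A t ->
    exists2 d, 0 < d & forall s, `|s| < d -> A (t + s).
  rewrite openE => /(_ t) + At => /(_ At) /nbhs_ballP[d /= d0 Hd].
  exists d => // s sd; apply: Hd.
  by rewrite /ball/= opprD addNKr normrN.
have [d1 d10 H1] := op _ _ Io (JI _ Ja).
have [d2 d20 H2] := op _ _ Io Ix.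
have [d3 d30 H3] := op _ _ Jo Ja.
pose r := Num.min d1 d2 / 4.
have r0 : 0 < r by rewrite divr_gt0// lt_min d10 d20.
have [rd1 rd2] : 2 * r < d1 /\ 2 * r < d2.
  have : Num.min d1 d2 <= d1 /\ Num.min d1 d2 <= d2 by rewrite !ge_min !lexx orbT.
  by rewrite /r; lra.
pose T := x 0 i0 - a.
have -> : x = (x - T *: e) + T *: e by rewrite subrK.
apply: (@vanish_along_segment g _ r (d3 / 2)) => //.
- by rewrite divr_gt0.
- move=> th /andP[th0 th1]; apply: harmonic_on_sub Hg => y /(_ i0).
  rewrite !mxE !eqxx !mulr1 /slab/= => yr.
  pose zz := y 0 i0 - (a + th * T).
  have zr : `|zz| <= 2 * r.
    by apply: le_trans yr; rewrite /zz /T le_eqVlt; apply/orP; left; apply/eqP; congr (`|_|); ring.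
  have I1 := H1 zz (le_lt_trans zr rd1).
  have I2 := H2 zz (le_lt_trans zr rd2).
  have yE : y 0 i0 = a + th * T + zz by rewrite /zz addrC subrK.
  have xE : x 0 i0 = a + T by rewrite /T addrC subrK.
  rewrite xE in I2.
  have [T0|T0] := leP 0 T.
    apply: (Ii _ _ I1 I2); rewrite yE.
    by have := mulr_ge0 th0 T0; have := ler_wpM2r T0 th1; lra.
  apply: (Ii _ _ I2 I1); rewrite yE.
  by have := mulr_ge0_le0 th0 (ltW T0); have := ler_wnM2r (ltW T0) th1; lra.
- move=> tau td; apply: g0; rewrite /slab/= !mxE !eqxx !mulr1.
  rewrite /T opprB (addrC _ (a - _)) subrK; apply: H3; lra.
Qed.

End UniqueContinuation.

(** * Calculus of iterated partial derivatives *)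

Definition real_laplacian (R : realType) (n : nat) (g : 'rV[R]_n -> R) :
    'rV[R]_n -> R :=
  fun x => \sum_(i < n) partial i (partial i g) x.

Section DerivativeCalculus.
Context (R : realType) (n : nat).
Implicit Types (G : set 'rV[R]_n) (g h : 'rV[R]_n -> R) (x v : 'rV[R]_n).

Lemma open_eq_near G g h x :
  open G -> (forall y, G y -> g y = h y) -> G x -> \forall y \near x, g y = h y.
Proof.
move=> Go gh Gx; have := open_nbhs_nbhs (conj Go Gx).
by apply: filterS => y /gh.
Qed.

Lemma partial_eq G g h i : open G -> (forall x, G x -> g x = h x) ->
  forall x, G x -> partial i g x = partial i h x.
Proof. by move=> Go gh x Gx; rewrite /partial; apply: near_eq_derive; exact: (open_eq_near Go gh Gx). Qed.

Lemma difference_quotient_shift g v x w :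
  (fun t : R => t^-1 *: (((fun y => g (y + v)) \o shift x) (t *: w) - g (x + v))) =
  (fun t : R => t^-1 *: ((g \o shift (x + v)) (t *: w) - g (x + v))).
Proof. by apply/funext => t; rewrite /= addrA. Qed.

Lemma partial_shift g v i :
  partial i (fun x => g (x + v)) = (fun x => partial i g (x + v)).
Proof.
by apply/funext => x; rewrite /partial /derive difference_quotient_shift.
Qed.

Lemma derivable_shift g v x w :
  derivable g (x + v) w -> derivable (fun y => g (y + v)) x w.
Proof. by rewrite /derivable difference_quotient_shift. Qed.

Lemma continuous_for_eq G g h : open G -> (forall x, G x -> g x = h x) ->
  (forall x, G x -> {for x, continuous g}) -> forall x, G x -> {for x, continuous h}.
Proof.
move=> Go gh gc x Gx; have := gc x Gx.
rewrite /prop_for /continuous_at -(gh x Gx); apply: cvg_trans.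
have gh0 := open_eq_near Go gh Gx.
apply: (@near_eq_cvg _ _ (nbhs x)); by apply: filterS gh0 => y ->.
Qed.

Lemma continuously_differentiable_eq k G g h :
  open G -> (forall x, G x -> g x = h x) ->
  continuously_differentiable k G g -> continuously_differentiable k G h.
Proof.
move=> Go; elim: k g h => [|k IH] g h gh [gc gd]; split.
- exact: (continuous_for_eq Go gh gc).
- by [].
- exact: (continuous_for_eq Go gh gc).
- move=> i; have [dg cg] := gd i; split.
    by move=> x Gx; apply: near_eq_derivable (dg x Gx); exact: (open_eq_near Go).
  by apply: IH cg; exact: partial_eq.
Qed.

Lemma continuously_differentiable_subset k G G' g :
  G' `<=` G -> continuously_differentiable k G g ->
  continuously_differentiable k G' g.
Proof.
move=> GG; elim: k g => [|k IH] g [gc gd]; (split; first by move=> x /GG/gc) => // i.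
have [dg cg] := gd i; split; last exact: IH.
by move=> x /GG; exact: dg.
Qed.

Lemma continuously_differentiable_leq k l G g :
  (k <= l)%N -> continuously_differentiable l G g ->
  continuously_differentiable k G g.
Proof.
elim: k l g => [|k IH] [|l] g // kl [gc gd]; split => // i.
by have [dg cg] := gd i; split => //; exact: IH cg.
Qed.

Lemma continuously_differentiable_local k G g :
  (forall x, G x -> exists2 G', G' x & continuously_differentiable k G' g) ->
  continuously_differentiable k G g.
Proof.
elim: k g => [|k IH] g H; split => //.
- by move=> x /H[G' G'x [gc _]]; exact: gc.
- by move=> x /H[G' G'x [gc _]]; exact: gc.
- move=> i; split; first by move=> x /H[G' G'x [_ /(_ i)[dg _]]]; exact: dg.
  by apply: IH => x /H[G' G'x [_ /(_ i)[_ cg]]]; exists G'.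
Qed.

Lemma continuously_differentiable_shift k G g v :
  continuously_differentiable k G g ->
  continuously_differentiable k [set x | G (x + v)] (fun x => g (x + v)).
Proof.
elim: k g => [|k IH] g [gc gd]; split => //.
- by move=> x /gc; exact: continuous_for_shift.
- by move=> x /gc; exact: continuous_for_shift.
- move=> i; have [dg cg] := gd i; split; last by rewrite partial_shift; exact: IH.
  by move=> x /dg; exact: derivable_shift.
Qed.

Lemma continuously_differentiable0 k G :
  continuously_differentiable k G (fun=> 0).
Proof.
have p0 i : partial i (fun _ : 'rV[R]_n => 0 : R) = fun=> 0.
  by apply/funext => x; exact: derive_cst.
elim: k => [|k IH]; split => //.
- by move=> x _; exact: cst_continuous.
- by move=> x _; exact: cst_continuous.
- by move=> i; rewrite p0; split => // x _; exact: derivable_cst.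
Qed.

Lemma continuously_differentiableD k G g h : open G ->
  continuously_differentiable k G g -> continuously_differentiable k G h ->
  continuously_differentiable k G (fun x => g x + h x).
Proof.
move=> Go; elim: k g h => [|k IH] g h [gc gd] [hc hd]; split => //.
- by move=> x Gx; apply: continuousD; [exact: gc | exact: hc].
- by move=> x Gx; apply: continuousD; [exact: gc | exact: hc].
- move=> i; have [dg cg] := gd i; have [dh ch] := hd i; split.
    by move=> x Gx; apply: derivableD; [exact: dg | exact: dh].
  apply: continuously_differentiable_eq (IH _ _ cg ch) => // x Gx.
  by rewrite /partial -deriveD//; [exact: dg | exact: dh].
Qed.

Lemma continuously_differentiableN k G g : open G ->
  continuously_differentiable k G g ->
  continuously_differentiable k G (fun x => - g x).
Proof.
move=> Go; elim: k g => [|k IH] g [gc gd]; split => //.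
- by move=> x Gx; apply: continuousN; exact: gc.
- by move=> x Gx; apply: continuousN; exact: gc.
- move=> i; have [dg cg] := gd i; split.
    by move=> x Gx; apply: derivableN; exact: dg.
  apply: continuously_differentiable_eq (IH _ cg) => // x Gx.
  by rewrite /partial -deriveN//; exact: dg.
Qed.

Lemma continuously_differentiableB k G g h : open G ->
  continuously_differentiable k G g -> continuously_differentiable k G h ->
  continuously_differentiable k G (fun x => g x - h x).
Proof.
move=> Go Hg Hh; apply: (continuously_differentiableD Go Hg).
exact: continuously_differentiableN.
Qed.

Lemma continuously_differentiable_laplacian k G g : open G ->
  continuously_differentiable k.+2 G g ->
  continuously_differentiable k G (real_laplacian g).
Proof.
move=> Go [_ Hg].
have pp i : continuously_differentiable k G (partial i (partial i g)).
  by have [_ [_ /(_ i)[]]] := Hg i.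
rewrite /real_laplacian.
elim: (index_enum _) => [|i s IH].
  under eq_fun do rewrite big_nil; exact: continuously_differentiable0.
under eq_fun do rewrite big_cons.
exact: continuously_differentiableD.
Qed.

Lemma real_laplacian_eq G g h : open G -> (forall x, G x -> g x = h x) ->
  forall x, G x -> real_laplacian g x = real_laplacian h x.
Proof.
move=> Go gh x Gx; apply: eq_bigr => i _.
by apply: (partial_eq _ Go) => // y Gy; exact: (partial_eq _ Go).
Qed.

Lemma iter_laplacian_eq N G g h : open G -> (forall x, G x -> g x = h x) ->
  forall x, G x ->
    iter N (@real_laplacian R n) g x = iter N (@real_laplacian R n) h x.
Proof.
move=> Go gh; elim: N => [|N IH] x Gx; first exact: gh.
rewrite !iterS; exact: (real_laplacian_eq Go IH Gx).
Qed.

Lemma iter_laplacian_shift N g v :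
  iter N (@real_laplacian R n) (fun x => g (x + v)) =
  (fun x => iter N (@real_laplacian R n) g (x + v)).
Proof.
elim: N => [|N IH]; first exact: erefl.
rewrite iterS IH; apply/funext => x; rewrite iterS /real_laplacian.
by apply: eq_bigr => i _; rewrite !partial_shift.
Qed.

Lemma real_laplacianB G g h : open G ->
  continuously_differentiable 2 G g -> continuously_differentiable 2 G h ->
  forall x, G x ->
    real_laplacian (fun y => g y - h y) x = real_laplacian g x - real_laplacian h x.
Proof.
move=> Go [_ Hg] [_ Hh] x Gx; rewrite /real_laplacian -sumrB; apply: eq_bigr => i _.
have [dg [_ /(_ i)[ddg _]]] := Hg i; have [dh [_ /(_ i)[ddh _]]] := Hh i.
rewrite (partial_eq i (h := fun y => partial i g y - partial i h y) Go)//.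
  by rewrite /partial -deriveB//; [exact: ddg | exact: ddh].
by move=> y Gy; rewrite /partial -deriveB//; [exact: dg | exact: dh].
Qed.

Lemma iter_laplacianB N G g h : open G ->
  continuously_differentiable (2 * N) G g ->
  continuously_differentiable (2 * N) G h ->
  forall x, G x -> iter N (@real_laplacian R n) (fun y => g y - h y) x =
    iter N (@real_laplacian R n) g x - iter N (@real_laplacian R n) h x.
Proof.
move=> Go; elim: N g h => [|N IH] g h Hg Hh x Gx; first exact: erefl.
rewrite mulnS in Hg Hh; rewrite !iterSr.
rewrite -(IH _ _ (continuously_differentiable_laplacian Go Hg)
  (continuously_differentiable_laplacian Go Hh) x Gx).
apply: (iter_laplacian_eq N Go _ Gx) => y Gy.
have le2 : (2 <= 2 + 2 * N)%N by rewrite leq_addr.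
exact: (real_laplacianB Go (continuously_differentiable_leq le2 Hg)
  (continuously_differentiable_leq le2 Hh) Gy).
Qed.

Lemma is_derive_along g x v (t l : R) :
  is_derive (x + t *: v) v g l -> is_derive t (1 : R) (fun s => g (x + s *: v)) l.
Proof.
have E : (fun h : R => h^-1 *: ((g \o shift (x + t *: v)) (h *: v) - g (x + t *: v))) =
  (fun h : R => h^-1 *: (((fun s => g (x + s *: v)) \o shift t) (h *: (1 : R)) -
     g (x + t *: v))).
  apply/funext => h; rewrite /= (_ : h *: (1 : R) = h); last exact: mulr1.
  by rewrite scalerDl addrCA.
move=> [D <-]; split; first by move: D; rewrite /derivable E.
by rewrite /derive E.
Qed.

Lemma harmonic_on_of_laplacian G g : open G ->
  continuously_differentiable 2 G g -> (forall x, G x -> real_laplacian g x = 0) ->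
  harmonic_on G g.
Proof.
move=> Go [gc Hg] g0 x Gx; split; first exact: gc.
exists (fun i => partial i (partial i g) x); split; last exact: g0.
move=> i; have [dg [_ /(_ i)[ddg _]]] := Hg i.
exists (fun t => partial i g (x + t *: delta_mx 0 i)); split.
  have C : (fun t : R => x + t *: (delta_mx 0 i : 'rV[R]_n)) @ (0 : R) --> x.
    have : {for (0 : R), continuous (fun t : R => x + t *: (delta_mx 0 i : 'rV[R]_n))}.
      apply: (@continuousD _ _ _ (cst x) (fun t : R => t *: (delta_mx 0 i : 'rV[R]_n))).
        exact: cst_continuous.
      by apply: cvgZr_tmp => ? ?.
    by rewrite /prop_for /continuous_at scale0r addr0.
  have CG : \forall t \near (0 : R), G (x + t *: delta_mx 0 i).
    exact: C (open_nbhs_nbhs (conj Go Gx)).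
  apply: filterS CG => t Gt.
  by apply: is_derive_along; exact: (derivableP (dg _ Gt)).
apply: is_derive_along; rewrite scale0r addr0; exact: (derivableP (ddg _ Gx)).
Qed.

End DerivativeCalculus.

Lemma slab_open (R : realType) (n : nat) (i0 : 'I_n) (I : set R) :
  open I -> open (slab i0 I).
Proof.
move=> Io; have /continuousP := @coord_continuous R 1 n 0 i0.
by move=> /(_ I Io).
Qed.

(** * Unique continuation for polyharmonic functions *)

(** By induction the Laplacian of [g], of order [N], vanishes on the whole slab;
    then [g] is harmonic there. *)
Lemma polyharmonic_unique_continuation (R : realType) (n : nat) (i0 : 'I_n)
    (I J : set R) (N : nat) (g : 'rV[R]_n -> R) :
  open I -> is_interval I -> open J -> J !=set0 -> J `<=` I ->
  continuously_differentiable (2 * N) (slab i0 I) g ->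
  (forall x, slab i0 I x -> iter N (@real_laplacian R n) g x = 0) ->
  (forall x, slab i0 J x -> g x = 0) ->
  forall x, slab i0 I x -> g x = 0.
Proof.
move=> Io Ii Jo J0 JI; have So := slab_open (i0 := i0) Io.
elim: N g => [|N IH] g gd gN gJ; first exact: gN.
rewrite mulnS in gd.
have Lg : forall x, slab i0 I x -> real_laplacian g x = 0.
  apply: IH.
  - exact: continuously_differentiable_laplacian.
  - by move=> x /gN; rewrite iterSr.
  - have So' := slab_open (i0 := i0) Jo.
    move=> x Jx; rewrite (real_laplacian_eq (h := fun=> 0) So')//.
    rewrite /real_laplacian big1// => i _.
    have p0 : partial i (fun _ : 'rV[R]_n => 0 : R) = fun=> 0.
      by apply/funext => y; exact: derive_cst.
    by rewrite !p0.
apply: (harmonic_unique_continuation Io Ii Jo J0 JI) => //.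
apply: harmonic_on_of_laplacian => //.
exact: continuously_differentiable_leq gd.
Qed.

(** * Periodicity and periodic extension *)

(** The Laplacian acts on real and imaginary parts separately, so that unique
    continuation is needed for real-valued functions only. *)
Definition real_polyharmonic (R : realType) (n N : nat) (G : set 'rV[R]_n)
    (g : 'rV[R]_n -> R) : Prop :=
  continuously_differentiable (2 * N) G g /\
  forall x, G x -> iter N (@real_laplacian R n) g x = 0.

Section Polyharmonic.
Context (R : realType) (n : nat).
Implicit Types (G : set 'rV[R]_n) (g h : 'rV[R]_n -> R) (f : 'rV[R]_n -> R[i]).
Implicit Types (x v : 'rV[R]_n) (N : nat).

Lemma Re_iter_laplacian N f x : complex.Re (iter N (@laplacian R n) f x) =
  iter N (@real_laplacian R n) (fun z => complex.Re (f z)) x.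
Proof.
elim: N x => //= N IH x; rewrite -(funext IH) /laplacian.
by rewrite (big_morph (@complex.Re R) (id1 := 0) (op1 := +%R))// => -[? ?] [].
Qed.

Lemma Im_iter_laplacian N f x : complex.Im (iter N (@laplacian R n) f x) =
  iter N (@real_laplacian R n) (fun z => complex.Im (f z)) x.
Proof.
elim: N x => //= N IH x; rewrite -(funext IH) /laplacian.
by rewrite (big_morph (@complex.Im R) (id1 := 0) (op1 := +%R))// => -[? ?] [].
Qed.

Lemma polyharmonicP N G f : polyharmonic N G f <->
  real_polyharmonic N G (fun x => complex.Re (f x)) /\
  real_polyharmonic N G (fun x => complex.Im (f x)).
Proof.
split=> [[rd id f0]|[[rd r0] [id i0]]].
  split; split=> // x Gx; rewrite -?Re_iter_laplacian -?Im_iter_laplacian;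
  by rewrite f0.
split=> // x Gx; apply/eqP; rewrite eq_complex.
by rewrite Re_iter_laplacian Im_iter_laplacian r0// i0// !eqxx.
Qed.

Lemma real_polyharmonic_shift N G G' g v :
  (forall x, G' x -> G (x + v)) -> real_polyharmonic N G g ->
  real_polyharmonic N G' (fun x => g (x + v)).
Proof.
move=> GG [gd g0]; split.
  apply: continuously_differentiable_subset GG _.
  exact: continuously_differentiable_shift.
by move=> x /GG Gx; rewrite iter_laplacian_shift g0.
Qed.

Lemma real_polyharmonicB N G g h : open G ->
  real_polyharmonic N G g -> real_polyharmonic N G h ->
  real_polyharmonic N G (fun x => g x - h x).
Proof.
move=> Go [gd g0] [hd h0]; split; first exact: continuously_differentiableB.
by move=> x Gx; rewrite (iter_laplacianB Go)// g0// h0// subrr.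
Qed.

Lemma real_polyharmonic_local N G g :
  (forall x, G x -> exists G' h, [/\ open G', G' x,
     forall y, G' y -> h y = g y & real_polyharmonic N G' h]) ->
  real_polyharmonic N G g.
Proof.
move=> H; split.
  apply: continuously_differentiable_local => x /H[G' [h [Go Gx hg [hd _]]]].
  by exists G' => //; exact: continuously_differentiable_eq hg hd.
move=> x /H[G' [h [Go Gx hg [_ h0]]]].
by rewrite -(iter_laplacian_eq N Go hg Gx) h0.
Qed.

Variable i0 : 'I_n.
Local Notation e := (delta_mx (0 : 'I_1) i0 : 'rV[R]_n).

Lemma coord_shift x (t : R) : (x + t *: e) 0 i0 = x 0 i0 + t.
Proof. by rewrite !mxE !eqxx mulr1. Qed.

(** Unique continuation for [g(x + p e) - g(x)], on the slab over the interval
    [K] of those [t] for which both [t] and [t + p] lie in [I]. *)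
Lemma real_periodic_of_locally_periodic (I J : set R) (p : R) N g :
  open I -> is_interval I -> open J -> J !=set0 ->
  (forall t, J t -> I t /\ I (t + p)) -> real_polyharmonic N (slab i0 I) g ->
  (forall x, slab i0 J x -> g (x + p *: e) = g x) ->
  forall x, I (x 0 i0) -> I (x 0 i0 + p) -> g (x + p *: e) = g x.
Proof.
move=> Io Ii Jo J0 JI Hg gJ x Ix Ixp.
pose K := [set t | I t /\ I (t + p)].
have Ko : open K.
  apply: openI => //; apply: (@open_comp _ _ (fun t : R => t + p)) => // t _.
  by apply: (@continuousD _ _ _ id (cst p) t); [move=> ? ? | exact: cst_continuous].
have Ki : is_interval K.
  move=> s t [Is Isp] [It Itp] z /andP[sz zt]; split.
    by apply: (Ii _ _ Is It); rewrite sz.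
  by apply: (Ii _ _ Isp Itp); rewrite !lerD2r sz.
have So := slab_open (i0 := i0) Ko.
have [wd w0] : real_polyharmonic N (slab i0 K) (fun x => g (x + p *: e) - g x).
  apply: real_polyharmonicB => //.
    apply: real_polyharmonic_shift Hg => y [_ Iyp].
    by rewrite /slab/= coord_shift.
  have [gd g0] := Hg; split; last by move=> y [Iy _]; exact: g0.
  by apply: continuously_differentiable_subset gd => y [].
apply/eqP; rewrite -subr_eq0; apply/eqP.
apply: (polyharmonic_unique_continuation Ko Ki Jo J0 _ wd w0) => //.
by move=> y Jy; rewrite gJ// subrr.
Qed.

Lemma periodic_of_locally_periodic (I J : set R) (p : R) N f :
  open I -> is_interval I -> open J -> J !=set0 ->
  (forall t, J t -> I t /\ I (t + p)) -> polyharmonic N (slab i0 I) f ->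
  (forall x, slab i0 J x -> f (x + p *: e) = f x) ->
  forall x, I (x 0 i0) -> I (x 0 i0 + p) -> f (x + p *: e) = f x.
Proof.
move=> Io Ii Jo J0 JI /polyharmonicP[Hr Hi] fJ x Ix Ixp.
apply/eqP; rewrite eq_complex; apply/andP; split; apply/eqP.
  apply: (real_periodic_of_locally_periodic Io Ii Jo J0 JI Hr) => // y Jy.
  by rewrite fJ.
apply: (real_periodic_of_locally_periodic Io Ii Jo J0 JI Hi) => // y Jy.
by rewrite fJ.
Qed.

(** The intermediate translates stay in the slab because [I] is an interval. *)
Lemma periodic_multiple (T : Type) (I : set R) (p : R) (f : 'rV[R]_n -> T) :
  is_interval I -> 0 <= p ->
  (forall x, I (x 0 i0) -> I (x 0 i0 + p) -> f (x + p *: e) = f x) ->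
  forall (m : int) x, I (x 0 i0) -> I (x 0 i0 + m%:~R * p) ->
    f (x + (m%:~R * p) *: e) = f x.
Proof.
move=> Ii p0 fp.
have nat_multiple (k : nat) x : I (x 0 i0) -> I (x 0 i0 + k%:R * p) ->
    f (x + (k%:R * p) *: e) = f x.
  elim: k => [|k IH] Ix; first by move=> _; rewrite mul0r scale0r addr0.
  rewrite -natr1 mulrDl mul1r addrA => Ixp.
  have Ik : I (x 0 i0 + k%:R * p).
    by apply: (Ii _ _ Ix Ixp); rewrite !lerDl p0 mulr_ge0.
  by rewrite scalerDl addrA fp ?coord_shift// IH.
move=> [k|k] x Ix Ixp; first exact: nat_multiple.
rewrite NegzE mulrNz mulNr in Ixp *.
have := nat_multiple k.+1 (x + (- (k.+1%:R * p)) *: e).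
by rewrite coord_shift subrK -addrA -scalerDl addNr scale0r addr0 => ->.
Qed.

(** The value at [x] is that of [f] at the translate [x + k(x) p e] whose
    coordinate lies between [a] and [a + p].  By periodicity any other integer [m] that
    brings [x] into the slab gives the same value ([vE]), so near [x] a single
    [m] serves and the extension is a translate of [f] there. *)
Lemma polyharmonic_periodic_extension (I : set R) (a p : R) N f :
  open I -> is_interval I -> 0 < p -> I a -> I (a + p) ->
  polyharmonic N (slab i0 I) f ->
  (forall x, I (x 0 i0) -> I (x 0 i0 + p) -> f (x + p *: e) = f x) ->
  exists v : 'rV[R]_n -> R[i], [/\ polyharmonic N setT v, forall x, slab i0 I x -> v x = f x
    & forall x, v (x + p *: e) = v x].
Proof.
move=> Io Ii p0 Ia Iap fh fp.
have fm := periodic_multiple Ii (ltW p0) fp.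
pose k x : int := - Num.floor ((x 0 i0 - a) / p).
pose v x := f (x + ((k x)%:~R * p) *: e).
have Ik x : I (x 0 i0 + (k x)%:~R * p).
  apply: (Ii _ _ Ia Iap).
  have /andP[] := floor_itv ((x 0 i0 - a) / p).
  rewrite ler_pdivlMr// ltr_pdivrMr// /k; move: (Num.floor _) => q.
  rewrite intrD mulrDl mulr1z mul1r mulrNz mulNr => ? ?.
  by apply/andP; split; lra.
have vE (m : int) x : I (x 0 i0 + m%:~R * p) -> v x = f (x + (m%:~R * p) *: e).
  move=> Im; rewrite /v.
  have E : m%:~R * p + (k x - m)%:~R * p = (k x)%:~R * p.
    by rewrite -mulrDl -intrD [m + _]addrC subrK.
  have F : x + ((k x)%:~R * p) *: e = x + (m%:~R * p) *: e + ((k x - m)%:~R * p) *: e.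
    by rewrite -addrA -scalerDl E.
  by rewrite F fm// coord_shift// -addrA E.
have vloc x : exists2 m : int, I (x 0 i0 + m%:~R * p) &
    forall y : 'rV[R]_n, I (y 0 i0 + m%:~R * p) -> f (y + (m%:~R * p) *: e) = v y.
  by exists (k x) => // y Iy; rewrite -vE.
exists v; split.
- have shiftI (m : int) : open [set x : 'rV[R]_n | I (x 0 i0 + m%:~R * p)].
    apply: (slab_open (i0 := i0) (I := [set t | I (t + m%:~R * p)])).
    apply: (@open_comp _ _ (fun t : R => t + m%:~R * p)) => // t _.
    by apply: (@continuousD _ _ _ id (cst _) t); [move=> ? ? | exact: cst_continuous].
  have sub (m : int) x : I (x 0 i0 + m%:~R * p) -> slab i0 I (x + (m%:~R * p) *: e).
    by rewrite /slab/= coord_shift.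
  move/polyharmonicP : fh => [Hr Hi].
  apply/polyharmonicP; split; apply: real_polyharmonic_local => x _;
    have [m Im vm] := vloc x.
  + exists [set x : 'rV[R]_n | I (x 0 i0 + m%:~R * p)].
    exists (fun x => complex.Re (f (x + (m%:~R * p) *: e))); split => //.
      by move=> y /vm ->.
    exact: (real_polyharmonic_shift (sub m) Hr).
  + exists [set x : 'rV[R]_n | I (x 0 i0 + m%:~R * p)].
    exists (fun x => complex.Im (f (x + (m%:~R * p) *: e))); split => //.
      by move=> y /vm ->.
    exact: (real_polyharmonic_shift (sub m) Hi).
- move=> x Ix; rewrite (vE 0) mul0r ?scale0r addr0//.
- move=> x; have E : p + (k x - 1)%:~R * p = (k x)%:~R * p.
    by rewrite intrB mulrBl mul1r addrC subrK.
  by rewrite (vE (k x - 1)) ?coord_shift -addrA ?E// -scalerDl E.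
Qed.

End Polyharmonic.

(** * Strips and odd functions *)

Section Strip.
Context (R : realType) (d : nat).
Implicit Types (a b : \bar R).

Local Notation e0 := (delta_mx (0 : 'I_1) (0 : 'I_(1 + d)) : 'rV[R]_(1 + d)).

Lemma pt_shift (t s : R) (y : 'rV[R]_d) : pt (t + s) y = pt t y + s *: e0.
Proof.
apply/rowP => i; rewrite !mxE; case: splitP => j ij; rewrite ?mxE.
  by rewrite (_ : i = 0) ?eqxx ?mulr1//; apply/val_inj; rewrite /= ij; case: j {ij} => -[].
rewrite (_ : (i == 0) = false) ?andbF ?mulr0 ?addr0//.
by apply/negbTE; rewrite -val_eqE/= ij.
Qed.

Lemma pt_coord (t : R) (y : 'rV[R]_d) : pt t y 0 0 = t.
Proof.
rewrite !mxE; case: splitP => j ij; first by rewrite ?mxE.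
by have := ij; rewrite /= add1n.
Qed.

Lemma pt_eta (x : 'rV[R]_(1 + d)) : x = pt (x 0 0) (rsubmx x).
Proof.
rewrite -{1}(hsubmxK x) /pt; congr row_mx; apply/rowP => i; rewrite !mxE.
by congr (x _ _); apply/val_inj; case: i => -[].
Qed.

Definition ereal_itv a b : set R := [set t | (a < t%:E < b)%E].

Lemma strip_slab a b : strip a b = slab (0 : 'I_(1 + d)) (ereal_itv a b).
Proof.
apply/seteqP; split => x; first by move=> [t [y [-> tab]]]; rewrite /slab/= pt_coord.
by move=> xab; exists (x 0 0), (rsubmx x); split => //; exact: pt_eta.
Qed.

Lemma ereal_itv_open a b : open (ereal_itv a b).
Proof.
have -> : ereal_itv a b = [set t | (a < t%:E)%E] `&` [set t | (t%:E < b)%E].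
  by apply/seteqP; split => t; [move=> /andP[] | move=> [? ?]; apply/andP].
apply: openI.
- case: a => [a| |].
  + by under eq_set do rewrite lte_fin; exact: open_gt.
  + by rewrite (_ : [set _ | _] = set0); [exact: open0 | apply/seteqP; split].
  + by rewrite (_ : [set _ | _] = setT); [exact: openT | apply/seteqP; split => // t _; rewrite /= ltNyr].
- case: b => [b| |].
  + by under eq_set do rewrite lte_fin; exact: open_lt.
  + by rewrite (_ : [set _ | _] = setT); [exact: openT | apply/seteqP; split => // t _; rewrite /= ltry].
  + by rewrite (_ : [set _ | _] = set0); [exact: open0 | apply/seteqP; split].
Qed.

Lemma ereal_itv_is_interval a b : is_interval (ereal_itv a b).
Proof.
move=> s t /andP[as' _] /andP[_ tb] z /andP[sz zt]; apply/andP; split.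
  by apply: lt_le_trans as' _; rewrite lee_fin.
by apply: le_lt_trans tb; rewrite lee_fin.
Qed.

Lemma odd_at_near a b (t0 r s : R) (u : 'rV[R]_(1 + d) -> R[i]) y :
  odd_at a b t0 u -> (a < (t0 - r)%:E)%E -> ((t0 + r)%:E < b)%E -> `|s| <= r ->
  u (pt (t0 + s) y) = - u (pt (t0 - s) y).
Proof.
move=> uo ar rb sr; apply: uo; rewrite lt_min; apply/andP; split.
  case: b rb => [b| |] rb; last by move: rb; rewrite ltNge leNye.
    by move: rb; rewrite -EFinB !lte_fin; lra.
  by rewrite /= ltry.
case: a ar => [a| |] ar; first by move: ar; rewrite -EFinB !lte_fin; lra.
  by have := lt_trans ar (ltry _); rewrite ltxx.
by rewrite /= ltry.
Qed.

End Strip.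

Unset Implicit Arguments.

Theorem theorem13 (R : realType) (d N : nat) (a b : \bar R) (t1 t2 : R)
    (u : 'rV[R]_(1 + d) -> R[i]) :
  (1 <= d)%N ->
  polyharmonic N (strip a b) u ->
  (a < t1%:E < b)%E -> (a < t2%:E < b)%E -> t1 < t2 ->
  odd_at a b t1 u -> odd_at a b t2 u ->
  (a < (t1 - (t2 - t1))%:E)%E -> ((t2 + (t2 - t1))%:E < b)%E ->
  exists v : 'rV[R]_(1 + d) -> R[i],
    [/\ polyharmonic N setT v,
        forall x, strip a b x -> v x = u x
      & forall (t : R) (y : 'rV[R]_d),
          v (pt (t + 2 * (t2 - t1)) y) = v (pt t y)].
Proof.
move=> _; rewrite strip_slab => uh t1ab t2ab t12 odd1 odd2 at1 t2b.
set p := 2 * (t2 - t1).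
have Ii := @ereal_itv_is_interval R a b; have Io := @ereal_itv_open R a b.
have inI t : t1 - (t2 - t1) <= t <= t2 + (t2 - t1) -> ereal_itv a b t.
  move=> /andP[l r]; apply/andP; split.
    by apply: lt_le_trans at1 _; rewrite lee_fin.
  by apply: le_lt_trans t2b; rewrite lee_fin.
(* The composition of the reflections at [t1] and [t2] is the translation by
   [p]; for [t1 - (t2 - t1) <= t < t1] both are applied at a distance at most
   [t2 - t1] from their centres. *)
have uJ (x : 'rV[R]_(1 + d)) : slab 0 `]t1 - (t2 - t1), t1[%classic x ->
    u (x + p *: delta_mx 0 0) = u x.
  rewrite (@pt_eta R d x) /slab/= pt_coord in_itv/=.
  move: (x 0 0) (rsubmx (x : 'rV[R]_(1 + d))) => t y /andP[tl tr]; rewrite -pt_shift.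
  have o1 := odd_at_near (s := t1 - t) y odd1 at1.
  have o2 := odd_at_near (r := t2 - t1) (s := t + (t2 - t1) - t1) y odd2.
  have -> : t + p = t2 + (t + (t2 - t1) - t1) by rewrite /p; ring.
  rewrite o2.
  - have -> : t2 - (t + (t2 - t1) - t1) = t1 + (t1 - t) by ring.
    rewrite o1 ?opprK.
    + by congr (u (pt _ _)); ring.
    + by have /andP[_] := t2ab; congr (_ < _)%E; congr EFin; ring.
    + by rewrite ler_norml; lra.
  - by have /andP[+ _] := t1ab; congr (_ < _)%E; congr EFin; ring.
  - exact: t2b.
  - by rewrite ler_norml; lra.
have up := periodic_of_locally_periodic Io Ii (@interval_open _ _ _ _ _) _ _ uh uJ.
have [||||v [vh vu vp]] := polyharmonic_periodic_extension
    (a := t1 - (t2 - t1)) (p := p) Io Ii _ _ _ uh.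
- by rewrite /p; lra.
- by apply: inI; rewrite lexx; lra.
- by apply: inI; rewrite /p; lra.
- apply: up => //.
    by exists (t1 - (t2 - t1) / 2); rewrite /= in_itv/=; lra.
  by move=> t; rewrite /= in_itv/= => tJ; split; apply: inI; rewrite ?/p; lra.
by exists v; split => // t y; rewrite pt_shift.
Qed.
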